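(* Let $G \subseteq W = (\mathbb{Z}/2\mathbb{Z})^4 \rtimes S_5$ be an arbitrary subgroup. Then every element of $H^1(G, \mathfrak{P})$ is annihilated by $4$.
   Context: $W = (\mathbb{Z}/2\mathbb{Z})^4 \rtimes S_5$, where $(\mathbb{Z}/2\mathbb{Z})^4$ denotes $\{(a_1,\ldots,a_5) \in (\mathbb{Z}/2\mathbb{Z})^5 \mid a_1+\cdots+a_5=0\}$, acted upon by $S_5$ by permuting coordinates. $P$ is the free abelian group on the symbols $[e_1],\ldots,[e_5]$, and $\mathfrak{P} \subset P\otimes_{\mathbb{Z}}\mathbb{Q}$ is the subgroup generated by $P$ and the element $\frac12([e_1]+\cdots+[e_5])$. The group $W$ acts on $P$ and $\mathfrak{P}$: $S_5$ permutes the indices and $(a_1,\ldots,a_5)$ sends $[e_i]$ to $(-1)^{a_i}[e_i]$ (so elements of $W$ act as signed permutations with an even number of sign changes). Subgroups $G\subseteq W$ act on $\mathfrak{P}$ by restriction. *)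

(* Defs.v *)
From HB Require Import structures.
From mathcomp Require Import all_boot all_order all_algebra all_fingroup.
From mathcomp Require Import boolp.

Set Implicit Arguments.
Unset Strict Implicit.
Unset Printing Implicit Defensive.

Import GroupScope Order.TTheory GRing.Theory Num.Theory.
Local Open Scope ring_scope.

(* Groups act on the right throughout, following the library: the product     *)
(* s * t of permutations is "s, then t".  Read with the product of functions  *)
(* s \o t = t * s, a right action is a left action, and the cocycle identity  *)
(* below is the usual c (g \o h) = c g + g . c h.                             *)

Structure gmodule (gT : finGroupType) (M : zmodType) := GModule {
  gmodule_act :> {action gT &-> M};
  gmodule_actD : forall g, {morph gmodule_act^~ g : x y / x + y} }.

Section FirstCohomology.

Variables (gT : finGroupType) (M : zmodType) (to : gmodule gT M).
Variable G : {group gT}.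

Lemma gmodule_actB g : {morph to^~ g : x y / x - y}.
Proof.
by move=> x y /=; rewrite -{2}(subrK y x) [in RHS]gmodule_actD addrK.
Qed.

Lemma gmodule_act0 g : to 0 g = 0.
Proof. by apply: (addrI (to 0 g)); rewrite -gmodule_actD !addr0. Qed.

Definition cocycle : {pred {ffun subg_of G -> M}} :=
  [pred c : {ffun _ -> _} |
    [forall g, forall h, c (g * h)%g == to (c g) (sgval h) + c h]].

Lemma cocycleP (c : {ffun subg_of G -> M}) :
  reflect (forall g h, c (g * h)%g = to (c g) (sgval h) + c h) (c \in cocycle).
Proof.
apply: (iffP idP) => [/forallP Zc g h|Zc].
  by have /forallP/(_ h)/eqP := Zc g.
by apply/forallP=> g; apply/forallP=> h; rewrite Zc.
Qed.

Lemma cocycle_zmod_closed : zmod_closed cocycle.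
Proof.
split=> [|c d /cocycleP Zc /cocycleP Zd]; apply/cocycleP=> g h.
  by rewrite !ffunE gmodule_act0 addr0.
by rewrite !ffunE Zc Zd gmodule_actB opprD addrACA.
Qed.

HB.instance Definition _ :=
  GRing.isZmodClosed.Build {ffun subg_of G -> M} cocycle cocycle_zmod_closed.

Record Z1 := MkZ1 { Z1val :> {ffun subg_of G -> M}; _ : Z1val \in cocycle }.

HB.instance Definition _ := [isSub for Z1val].
HB.instance Definition _ := [Choice of Z1 by <:].
HB.instance Definition _ := [SubChoice_isSubZmodule of Z1 by <:].

Definition coboundary : {pred Z1} :=
  [pred c : Z1 | `[< exists x : M, forall g, c g = to x (sgval g) - x >]].

Lemma coboundaryP (c : Z1) :
  reflect (exists x : M, forall g, c g = to x (sgval g) - x)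
          (c \in coboundary).
Proof. exact: asboolP. Qed.

Lemma coboundary_zmod_closed : zmod_closed coboundary.
Proof.
split=> [|c d /coboundaryP[x cE] /coboundaryP[y dE]]; apply/coboundaryP.
  by exists 0 => g; rewrite gmodule_act0 subrr ffunE.
exists (x - y) => g; rewrite !ffunE cE dE gmodule_actB.
by rewrite !opprD addrACA.
Qed.

HB.instance Definition _ :=
  GRing.isZmodClosed.Build Z1 coboundary coboundary_zmod_closed.

Definition H1 : zmodType := Quotient.quot coboundary.

End FirstCohomology.

Definition even_vectors : {set 'rV['Z_2]_5} :=
  [set a : 'rV['Z_2]_5 | \sum_i a 0 i == 0].

Lemma even_vectors_group_set : group_set even_vectors.
Proof.
apply/group_setP; split=> [|a b]; rewrite !inE.
  by rewrite big1 // => i _; rewrite mxE.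
move=> /eqP a0 /eqP b0; under eq_bigr do rewrite mxE.
by rewrite big_split /= a0 b0 addr0.
Qed.
Canonical even_vectors_group := Group even_vectors_group_set.

(* The inverse makes this a right action: s moves the i-th coordinate to the  *)
(* (s i)-th place.                                                            *)
Definition permute_coords (a : 'rV['Z_2]_5) (s : 'S_5) : 'rV['Z_2]_5 :=
  col_perm s^-1%g a.

Lemma permute_coordsE a s j : permute_coords a s 0 j = a 0 (s^-1%g j).
Proof. by rewrite mxE. Qed.

Lemma permute_coords1 : permute_coords^~ 1%g =1 id.
Proof. by move=> a; apply/rowP=> j; rewrite permute_coordsE invg1 perm1. Qed.

Lemma permute_coordsM a : act_morph permute_coords a.
Proof.
by move=> s t; apply/rowP=> j; rewrite !permute_coordsE invMg permM.
Qed.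

Definition permute_action : {action 'S_5 &-> 'rV['Z_2]_5} :=
  TotalAction permute_coords1 permute_coordsM.

Lemma permute_is_groupAction :
  is_groupAction [set: 'rV['Z_2]_5] permute_action.
Proof.
move=> s _; rewrite inE; apply/andP; split; first by apply/subsetP=> a _.
apply/morphicP=> a b _ _; rewrite !actpermE /=.
by apply/rowP=> j; rewrite !mxE.
Qed.

Definition permute_groupAction := GroupAction permute_is_groupAction.

Lemma permute_acts_on_even_vectors :
  {acts [set: 'S_5], on group even_vectors | permute_groupAction}.
Proof.
split; last exact: subsetT.
apply/subsetP=> s _; rewrite !inE; apply/subsetP=> a; rewrite !inE => /eqP a0.
rewrite (reindex_inj (@perm_inj _ s)) /=.
by under eq_bigr do rewrite permute_coordsE permK; rewrite a0.
Qed.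

Definition W : finGroupType :=
  sdprod_by (actby_groupAction permute_acts_on_even_vectors).

(* w is the product of the permutation W_perm w followed by the sign changes  *)
(* W_signs w.                                                                 *)
Definition W_perm (w : W) : 'S_5 := (pair_of_sd w).1.
Definition W_signs (w : W) : 'rV['Z_2]_5 := (pair_of_sd w).2.

(* P is the lattice 'rV[int]_5 of integral vectors in 'rV[rat]_5, with [e_i]   *)
(* the basis vector 'e_i.                                                     *)
Definition half_sum : 'rV[rat]_5 := 2^-1 *: \sum_i 'e_i.

Definition frakP_generators : 6.-tuple 'rV[rat]_5 :=
  [tuple of half_sum :: [tuple 'e_i | i < 5]].

Lemma frakP_generatorsS (i : 'I_5) : frakP_generators`_(lift ord0 i) = 'e_i.
Proof. by rewrite [LHS](nth_map ord0) ?size_enum_ord // nth_ord_enum. Qed.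

Definition frakP_pred : {pred 'rV[rat]_5} :=
  [pred v | `[< inIntSpan frakP_generators v >]].

Lemma frakP_predP (v : 'rV[rat]_5) :
  reflect (exists (k : int) (p : 'rV[int]_5),
              v = half_sum *~ k + \sum_i 'e_i *~ p 0 i)
          (v \in frakP_pred).
Proof.
apply: (iffP (asboolP _)) => [[a ->]|[k [p ->]]].
  exists (a ord0), (\row_i a (lift ord0 i)).
  rewrite big_ord_recl; congr (_ + _).
  by apply: eq_bigr => i _; rewrite mxE frakP_generatorsS.
exists [ffun i => oapp (p 0) k (unlift ord0 i)].
rewrite [RHS]big_ord_recl ffunE unlift_none; congr (_ + _).
by apply: eq_bigr => i _; rewrite ffunE liftK frakP_generatorsS.
Qed.

Lemma frakP_zmod_closed : zmod_closed frakP_pred.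
Proof.
split=> [|u v /frakP_predP[k [p ->]] /frakP_predP[l [q ->]]]; apply/frakP_predP.
  by exists 0, 0; rewrite big1 ?addr0 // => i _; rewrite mxE.
exists (k - l), (p - q); rewrite mulrzBr opprD addrACA -sumrB.
by congr (_ + _); apply: eq_bigr => i _; rewrite !mxE mulrzBr.
Qed.

HB.instance Definition _ :=
  GRing.isZmodClosed.Build 'rV[rat]_5 frakP_pred frakP_zmod_closed.

Record frakP :=
  MkFrakP { frakP_val :> 'rV[rat]_5; _ : frakP_val \in frakP_pred }.

HB.instance Definition _ := [isSub for frakP_val].
HB.instance Definition _ := [Choice of frakP by <:].
HB.instance Definition _ := [SubChoice_isSubZmodule of frakP by <:].

Definition W_act_basis (i : 'I_5) (w : W) : 'rV[rat]_5 :=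
  (-1) ^+ W_signs w 0 (W_perm w i) *: 'e_(W_perm w i).

Definition W_act (v : 'rV[rat]_5) (w : W) : 'rV[rat]_5 :=
  \sum_i v 0 i *: W_act_basis i w.

Lemma W_actE v w j :
  W_act v w 0 j = (-1) ^+ W_signs w 0 j * v 0 ((W_perm w)^-1%g j).
Proof.
rewrite summxE (bigD1 ((W_perm w)^-1%g j)) //= big1 => [|i neq_i].
  by rewrite !mxE permKV !eqxx mulr1 mulrC addr0.
rewrite !mxE eqxx /= [j == _]eq_sym -(inj_eq (@perm_inj _ (W_perm w)^-1%g)) permK.
by rewrite (negPf neq_i) !mulr0.
Qed.

Lemma W_permM u w : W_perm (u * w)%g = (W_perm u * W_perm w)%g.
Proof. by []. Qed.

Lemma W_signsE u w j :
  W_signs (u * w)%g 0 j =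
  W_signs u 0 ((W_perm w)^-1%g j) + W_signs w 0 j.
Proof.
case: u w => [[s a] Ru] [[t b] Rw]; have /setXP[_ /= Ra] := Ru.
by rewrite /W_signs /W_perm /= mxE /actby Ra inE /= permute_coordsE.
Qed.

Lemma sign_Z2D (a b : 'Z_2) :
  (-1 : rat) ^+ (a + b)%R = (-1) ^+ a * (-1) ^+ b.
Proof.
by case: a b => [[|[|//]] ?] [[|[|//]] ?]; rewrite ?mul1r ?mulr1 ?mulrNN ?mulr1.
Qed.

Lemma W_act1 : W_act^~ 1%g =1 id.
Proof.
move=> v; apply/rowP=> j.
by rewrite W_actE /W_perm /W_signs /= mxE invg1 perm1 mul1r.
Qed.

Lemma W_actM v : act_morph W_act v.
Proof.
move=> u w; apply/rowP=> j.
by rewrite !W_actE W_signsE W_permM sign_Z2D invMg permM mulrCA mulrA.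
Qed.

Lemma W_actB w : {morph W_act^~ w : u v / u - v}.
Proof. by move=> u v; apply/rowP=> j; rewrite !(W_actE, mxE) mulrBr. Qed.

Definition W_endo w v := W_act v w.

HB.instance Definition _ w :=
  GRing.isZmodMorphism.Build 'rV[rat]_5 'rV[rat]_5 (W_endo w) (W_actB w).

Lemma W_act_delta i w : W_act 'e_i w = W_act_basis i w.
Proof.
rewrite /W_act (bigD1 i) //= big1 => [|j neq_j]; last first.
  by rewrite !mxE eqxx (negPf neq_j) scale0r.
by rewrite !mxE !eqxx scale1r addr0.
Qed.

Lemma frakP_delta i : 'e_i \in frakP_pred.
Proof.
apply/frakP_predP; exists 0, (delta_mx 0 i); rewrite add0r (bigD1 i) //= big1.
  by rewrite mxE !eqxx addr0.
by move=> j neq_j; rewrite mxE eqxx (negPf neq_j).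
Qed.

Lemma frakP_half_sum : half_sum \in frakP_pred.
Proof.
apply/frakP_predP; exists 1, 0; rewrite big1 ?addr0 // => i _.
by rewrite mxE.
Qed.

Lemma W_act_half_sum w :
  W_act half_sum w = half_sum - \sum_i 'e_i *+ W_signs w 0 i.
Proof.
have half_sumE j : half_sum 0 j = 2^-1.
  rewrite mxE summxE (bigD1 j) //= big1 => [|i neq_i].
    by rewrite mxE !eqxx addr0 mulr1.
  by rewrite mxE eqxx eq_sym (negPf neq_i).
apply/rowP=> j; rewrite W_actE half_sumE [RHS]mxE half_sumE mxE summxE (bigD1 j) //=.
rewrite big1 => [|i neq_i]; last first.
  by rewrite mulmxnE mxE eqxx eq_sym (negPf neq_i) mul0rn.
rewrite mulmxnE mxE !eqxx addr0.
by case: (W_signs w 0 j) => [[|[|//]] ?].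
Qed.

Lemma frakP_W_act (w : W) (v : 'rV[rat]_5) :
  v \in frakP_pred -> W_act v w \in frakP_pred.
Proof.
case/frakP_predP=> k [p ->].
rewrite -/(W_endo w _) raddfD raddf_sum /= raddfMz; apply: rpredD.
  apply: rpredMz; rewrite /= /W_endo W_act_half_sum rpredB ?frakP_half_sum //.
  by apply: rpred_sum => i _; rewrite rpredMn ?frakP_delta.
apply: rpred_sum => i _; rewrite raddfMz rpredMz //= /W_endo W_act_delta.
by rewrite /W_act_basis -signr_odd scaler_sign; case: ifP; rewrite ?rpredN frakP_delta.
Qed.

Definition frakP_act (x : frakP) (w : W) : frakP :=
  MkFrakP (frakP_W_act w (valP x)).

Lemma frakP_act1 : frakP_act^~ 1%g =1 id.
Proof. by move=> x; apply: val_inj; apply: W_act1. Qed.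

Lemma frakP_actM x : act_morph frakP_act x.
Proof. by move=> u w; apply: val_inj; apply: W_actM. Qed.

Lemma frakP_actD w : {morph frakP_act^~ w : x y / x + y}.
Proof. by move=> x y; apply: val_inj; apply: (raddfD (W_endo w)). Qed.

Definition frakP_module : gmodule W frakP :=
  @GModule _ _ (TotalAction frakP_act1 frakP_actM) frakP_actD.

(* Main.v *)
Require Import Defs.
From mathcomp Require Import all_boot all_order all_algebra all_fingroup.
Import GRing.Theory.
Local Open Scope ring_scope.

(** Averaging over [G] writes a cocycle [c] as [c g = v g - v] for a rational
vector [v], and [2 c g] is integral because [2 frakP] lies in the lattice [P].
Twice rounding to the nearest integer, with half-integers left fixed, is a map
[k] from rationals to integers with [k (- q) = - k q] and
[k (q + m) = k q + 2 m] for integers [m].  Applied coordinatewise it commutes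
with signed permutations, so rounding [(2 v) g = 2 v + 2 c g] in this way gives
[(k (2 v)) g = k (2 v) + 4 c g]: the integral vector [k (2 v)] exhibits [4 c]
as a coboundary. *)

(** Since [- floor (1/2 - q)] is the ceiling of [q - 1/2], this adds rounding with ties up and
    rounding with ties down; neither alone is odd. *)
Definition twice_round {R : archiRealFieldType} (q : R) : int :=
  Num.floor (q + 2^-1) - Num.floor (2^-1 - q).

Lemma twice_roundN (R : archiRealFieldType) (q : R) :
  twice_round (- q) = - twice_round q.
Proof. by rewrite /twice_round opprK opprB ![2^-1 + _]addrC. Qed.

(** The first floor gains [m] and the second loses [m]. *)
Lemma twice_roundDz (R : archiRealFieldType) (q : R) (m : int) :
  twice_round (q + m%:~R) = twice_round q + m *+ 2.
Proof.
have shift (x : R) n : Num.floor (x + n%:~R) = Num.floor x + n.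
  by rewrite Num.Theory.floorDrz ?Num.Theory.intr_int ?Num.Theory.intrKfloor.
by rewrite /twice_round addrAC opprD addrA -mulrNz !shift opprD opprK addrACA.
Qed.

Lemma twice_round_sign (R : archiRealFieldType) (n : nat) (q : R) :
  twice_round ((-1) ^+ n * q) = (-1) ^+ n * twice_round q.
Proof.
rewrite -signr_odd -[in RHS]signr_odd.
by case: odd; rewrite ?expr1 ?expr0 ?mul1r // !mulN1r twice_roundN.
Qed.

Lemma sum_delta_int (p : 'rV[int]_5) :
  \sum_i 'e_i *~ p 0 i = map_mx intr p :> 'rV[rat]_5.
Proof.
by rewrite [RHS]row_sum_delta; apply: eq_bigr => i _; rewrite mxE scaler_int.
Qed.

Lemma frakP_int (p : 'rV[int]_5) : map_mx intr p \in frakP_pred.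
Proof. by apply/frakP_predP; exists 0, p; rewrite add0r sum_delta_int. Qed.

Lemma frakP_mul2_int (v : 'rV[rat]_5) :
  v \in frakP_pred -> exists p : 'rV[int]_5, v *+ 2 = map_mx intr p.
Proof.
(* Doubling [half_sum] gives the all-ones vector, so its multiple by [k] contributes
   [const_mx k]. *)
case/frakP_predP=> k [p ->]; exists (const_mx k + p *+ 2).
rewrite sum_delta_int mulrnDl pmulrn mulrzAC -pmulrn.
have -> : half_sum *+ 2 = map_mx intr (const_mx 1 : 'rV[int]_5).
  rewrite -sum_delta_int /half_sum scalerMnl -mulr_natr mulVf // scale1r.
  by apply: eq_bigr => i _; rewrite mxE.
rewrite -raddfMz -raddfMn -raddfD; congr (map_mx _ (_ + _)).
by rewrite -raddfMz intz.
Qed.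

Definition twice_round_row (v : 'rV[rat]_5) : 'rV[int]_5 := map_mx twice_round v.

Lemma W_act_twice_round (v : 'rV[rat]_5) (w : W) :
  W_act (map_mx intr (twice_round_row v)) w =
  map_mx intr (twice_round_row (W_act v w)).
Proof.
apply/rowP=> j; rewrite !mxE W_actE !mxE W_actE twice_round_sign.
by rewrite rmorphM rmorph_sign.
Qed.

Lemma rat_coboundary (G : {group W}) (c : Z1 frakP_module G) :
  exists v : 'rV[rat]_5,
    forall g, frakP_val (c g) = W_act v (sgval g) - v.
Proof.
pose S : 'rV[rat]_5 := \sum_h frakP_val (c h).
(* Sum the cocycle identity for [h * g] over [h]; right translation by [g] permutes the group. *)
have S_act g : S = W_act S (sgval g) + frakP_val (c g) *+ #|subg_of G|.
  rewrite {1}/S (reindex_inj (mulIg g)) /=.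
  have /cocycleP Zc := valP c.
  under eq_bigr do rewrite Zc.
  rewrite big_split /= sumr_const.
  by rewrite -/(W_endo (sgval g) S) raddf_sum.
have N_neq0 : #|subg_of G|%:R != 0 :> rat.
  by rewrite Num.Theory.pnatr_eq0 -lt0n; apply/card_gt0P; exists 1%g.
(* The order of the group times [c g] is [S] minus its image under [g], hence the minus sign. *)
exists (- #|subg_of G|%:R^-1 *: S) => g.
apply: (scalerI N_neq0); rewrite scaler_nat.
have -> : frakP_val (c g) *+ #|subg_of G| = S - W_act S (sgval g).
  by rewrite {1}(S_act g) addrC addKr.
apply/rowP=> j; rewrite !(W_actE, mxE) !mulNr mulrN opprK.
by rewrite [_ ^+ _ * (_ * _)]mulrCA mulrDr mulrN !mulVKf // addrC.
Qed.

Theorem theorem3p6 (G : {group W}) (x : H1 frakP_module G) : x *+ 4 = 0.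
Proof.
elim/quotW: x => c; have [v cE] := rat_coboundary G c.
suff c4 : c *+ 4 \in coboundary (G:=G).
  apply/eqP; rewrite -[_ *+ 4]raddfMn.
  by rewrite -(raddf0 (\pi_(H1 frakP_module G))%qT) -Quotient.idealrBE subr0.
apply/coboundaryP.
exists (MkFrakP (frakP_int (twice_round_row (v *+ 2)))) => g.
apply: val_inj; rewrite /= !ffunE.
rewrite W_act_twice_round.
have [p c2] := frakP_mul2_int _ (valP (c g)).
(* [p *+ 2] is exactly the shift of [twice_round_row] under translation by [p]. *)
have c4 : val (c g) *+ 4 = map_mx intr (p *+ 2).
  by rewrite -[4%N]/(2 * 2)%N mulrnA c2 [RHS]raddfMn.
have -> : W_act (v *+ 2) (sgval g) = v *+ 2 + map_mx intr p.
  rewrite -c2 [val _]cE mulrnBl addrC subrK.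
  by rewrite -/(W_endo _ _) raddfMn.
have -> : twice_round_row (v *+ 2 + map_mx intr p) =
          twice_round_row (v *+ 2) + p *+ 2.
  by apply/rowP=> j; rewrite !mxE twice_roundDz mulr2n.
by rewrite [map_mx _ (_ + _)]raddfD /= addrAC subrr add0r -c4.
Qed.
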